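(* Let $A\in\mathbb{R}^{n\times n}$ be symmetric and $B\in\mathbb{R}^{n\times n}$ symmetric positive definite, and let $u\in\mathbb{R}^n$ satisfy $u^TABu\ne0$. Let $C=[\,Bu\ \ -Au\,]\in\mathbb{R}^{n\times2}$ and let $\mu$ be the smallest eigenvalue of $C^TC$. Put $\theta=\frac{u^TABu}{u^TB^2u}$ and $\widetilde\theta=\frac{u^TA^2u}{u^TABu}$. Then: (i) $\mu$ is a simple eigenvalue of $C^TC$ (equivalently, $\sqrt\mu$ is a simple singular value of $C$), and its corresponding unit eigenvector $[\alpha_1,\alpha_2]^T$ is, up to sign, the unique minimizer of $\|\alpha_1Bu-\alpha_2Au\|$ subject to $\alpha_1^2+\alpha_2^2=1$. (ii) $\mu=\tfrac12\Big[u^TA^2u+u^TB^2u-\sqrt{(u^TA^2u-u^TB^2u)^2+4(u^TABu)^2}\Big]$. (iii) The generalized homogeneous Rayleigh quotient $\alpha=\alpha_1/\alpha_2$ satisfies $$\alpha=\frac{1}{2\,u^TABu}\Big[u^TA^2u-u^TB^2u+\sqrt{(u^TA^2u-u^TB^2u)^2+4(u^TABu)^2}\Big].$$ (iv) $\mu=0$ if and only if $u$ is an eigenvector of the generalized eigenvalue problem $Ax=\lambda Bx$; and if $u$ is such an eigenvector, then $\alpha$ is the corresponding eigenvalue. (v) $0\le\mu<\min(u^TA^2u,\ u^TB^2u)$. (vi) If $u^TABu>0$ then $\theta\le\alpha\le\widetilde\theta$; if $u^TABu<0$ then $\widetilde\theta\le\alpha\le\theta$.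
   Context: $\|\cdot\|$ is the Euclidean norm. The generalized homogeneous Rayleigh quotient of $(A,B)$ at $u$ is $\alpha=\alpha_1/\alpha_2$, where $(\alpha_1,\alpha_2)$ (with $\alpha_2\ne0$) minimizes $\frac{\|\alpha_1Bu-\alpha_2Au\|}{\sqrt{\alpha_1^2+\alpha_2^2}}$ over the real projective line ($\mathbb{R}^2\setminus\{0\}$ modulo nonzero scalars); equivalently, $[\alpha_1,\alpha_2]^T$ minimizes $\|C[\alpha_1,\alpha_2]^T\|$ subject to $\alpha_1^2+\alpha_2^2=1$. An eigenvector of the generalized problem is a nonzero $x$ with $Ax=\lambda Bx$ for some $\lambda$. *)

(* Defs.v *)
(* MathComp world; [realType] is the type of models of the real line. *)
From mathcomp Require Import all_boot all_order all_algebra.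
From mathcomp Require Export reals.

Set Implicit Arguments.
Unset Strict Implicit.
Unset Printing Implicit Defensive.

Import Order.TTheory GRing.Theory Num.Theory.
Local Open Scope ring_scope.

(* The norm that MathComp-Analysis puts on matrices is the max norm. *)
Definition enorm (R : realType) (n : nat) (x : 'cV[R]_n) : R :=
  Num.sqrt (\sum_(i < n) x i 0 ^+ 2).

Definition quadform (R : realType) (n : nat) (M : 'M[R]_n) (x : 'cV[R]_n) : R :=
  (x^T *m M *m x) 0 0.

Definition posdefmx (R : realType) (n : nat) (M : 'M[R]_n) : Prop :=
  M \is symmetricmx /\ forall x : 'cV[R]_n, x != 0 -> 0 < quadform M x.

Definition smallest_eigenvalue (R : realType) (n : nat) (M : 'M[R]_n) (mu : R)
    : Prop :=
  eigenvalue M mu /\ forall l : R, eigenvalue M l -> mu <= l.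

(* Simplicity refers to the algebraic multiplicity. *)
Definition simple_eigenvalue (R : realType) (n : nat) (M : 'M[R]_n) (l : R)
    : Prop :=
  mup l (char_poly M) = 1%N.

(* The singular values of an m x n matrix M are taken to be the n nonnegative
   square roots of the eigenvalues of M^T M, counted with multiplicity, even
   when m < n. *)
Definition simple_singular_value (R : realType) (m n : nat) (M : 'M[R]_(m, n))
    (s : R) : Prop :=
  0 <= s /\ simple_eigenvalue (M^T *m M) (s ^+ 2).

(* The library's eigenvectors are row vectors; these are column vectors. *)
Definition unit_eigenvector (R : realType) (n : nat) (M : 'M[R]_n) (l : R)
    (x : 'cV[R]_n) : Prop :=
  M *m x = l *: x /\ enorm x = 1.

Definition gen_eigenpair (R : realType) (n : nat) (A B : 'M[R]_n) (l : R)
    (x : 'cV[R]_n) : Prop :=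
  x != 0 /\ A *m x = l *: (B *m x).

Definition gen_eigenvector (R : realType) (n : nat) (A B : 'M[R]_n)
    (x : 'cV[R]_n) : Prop :=
  exists l : R, gen_eigenpair A B l x.

(* A pair (alpha_1, alpha_2) is a vector a : 'cV_2 with alpha_1 = a 0 0 and
   alpha_2 = a 1 0. *)
Definition pencil_residual (R : realType) (n : nat) (A B : 'M[R]_n)
    (u : 'cV[R]_n) (a : 'cV[R]_2) : R :=
  enorm (a 0 0 *: (B *m u) - a 1 0 *: (A *m u)).

Definition unit_minimizer (R : realType) (n : nat) (A B : 'M[R]_n)
    (u : 'cV[R]_n) (a : 'cV[R]_2) : Prop :=
  a 0 0 ^+ 2 + a 1 0 ^+ 2 = 1 /\
  forall b : 'cV[R]_2, b 0 0 ^+ 2 + b 1 0 ^+ 2 = 1 ->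
    pencil_residual A B u a <= pencil_residual A B u b.

(* Points of the real projective line are represented by nonzero vectors; the
   minimized ratio does not depend on the representative. *)
Definition projective_minimizer (R : realType) (n : nat) (A B : 'M[R]_n)
    (u : 'cV[R]_n) (a : 'cV[R]_2) : Prop :=
  a != 0 /\
  forall b : 'cV[R]_2, b != 0 ->
    pencil_residual A B u a / Num.sqrt (a 0 0 ^+ 2 + a 1 0 ^+ 2)
    <= pencil_residual A B u b / Num.sqrt (b 0 0 ^+ 2 + b 1 0 ^+ 2).

(* A relation rather than a function: existence and uniqueness of the quotient
   are not built into the definition. *)
Definition gen_hom_rayleigh_quotient (R : realType) (n : nat) (A B : 'M[R]_n)
    (u : 'cV[R]_n) (alpha : R) : Prop :=
  exists a : 'cV[R]_2,
    [/\ projective_minimizer A B u a, a 1 0 != 0 & alpha = a 0 0 / a 1 0].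

Definition pencil_mx (R : realType) (n : nat) (A B : 'M[R]_n) (u : 'cV[R]_n)
    : 'M[R]_(n, 2) :=
  row_mx (B *m u) (- (A *m u)).

(* Main.v *)
Require Import Defs.
From mathcomp Require Import all_boot all_order all_algebra.
From mathcomp Require Import ring lra.
Import Order.TTheory GRing.Theory Num.Theory.
Local Open Scope ring_scope.

(* Completing the square with k = t - mu > 0, where t = u^T B^2 u, c = u^T A B u
   and (t - mu)(u^T A^2 u - mu) = c^2, the squared residual at (x, y) equals
   mu (x^2 + y^2) + (k x - c y)^2 / k.  Hence minimizers, unit eigenvectors for
   mu and the Rayleigh quotient are all governed by the single equation
   k x = c y. *)

(** * Characteristic polynomials and vectors in dimension two *)

Lemma char_poly2 (R : comNzRingType) (M : 'M[R]_2) :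
  char_poly M =
    ('X - (M 0 0)%:P) * ('X - (M 1 1)%:P) - (M 0 1 * M 1 0)%:P.
Proof.
rewrite /char_poly (expand_det_row _ 0) big_ord_recl big_ord1 /cofactor.
rewrite !det_mx11 !mxE /= !mulr1n !mulr0n.
have e01 : lift (0 : 'I_2) (0 : 'I_1) = 1 by exact: val_inj.
have e10 : lift (1 : 'I_2) (0 : 'I_1) = 0 by exact: val_inj.
by rewrite e01 e10 rmorphM /=; ring.
Qed.

(** Vieta's relations read backwards: trace and determinant are the only coefficients of the
    polynomial, so proposed roots need only match these two. *)
Lemma char_poly2_roots (R : comNzRingType) (M : 'M[R]_2) (r r' : R) :
  r + r' = M 0 0 + M 1 1 -> r * r' = M 0 0 * M 1 1 - M 0 1 * M 1 0 ->
  char_poly M = ('X - r%:P) * ('X - r'%:P).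
Proof.
move=> trE detE; rewrite char_poly2.
have -> : M 0 1 * M 1 0 = M 0 0 * M 1 1 - r * r' by rewrite detE; ring.
have -> : M 0 0 = r + r' - M 1 1 by rewrite trE; ring.
by rewrite !(polyCB, polyCD, polyCM); ring.
Qed.

Lemma cV2P (R : Type) (a b : 'cV[R]_2) :
  a 0 0 = b 0 0 -> a 1 0 = b 1 0 -> a = b.
Proof.
move=> e0 e1; apply/matrixP=> i j; rewrite ord1.
case: i => [[|[|//]] lti].
- by rewrite (_ : Ordinal lti = 0) //; apply: val_inj.
- by rewrite (_ : Ordinal lti = 1) //; apply: val_inj.
Qed.

(** * Euclidean norm, dot products and quadratic forms *)

Lemma enorm_sqr (R : realType) (n : nat) (x : 'cV[R]_n) :
  enorm x ^+ 2 = (x^T *m x) 0 0.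
Proof.
rewrite sqr_sqrtr; last by apply: sumr_ge0 => i _; exact: sqr_ge0.
by rewrite mxE; apply: eq_bigr => i _; rewrite mxE expr2.
Qed.

Lemma enorm_eq0 (R : realType) (n : nat) (x : 'cV[R]_n) : enorm x = 0 -> x = 0.
Proof.
move=> /(congr1 (fun z => z ^+ 2)); rewrite enorm_sqr expr0n mxE /= => /eqP.
rewrite psumr_eq0 => [/allP x0 | i _]; last by rewrite mxE -expr2 sqr_ge0.
apply/matrixP=> i j; rewrite ord1 mxE; apply/eqP.
by rewrite -sqrf_eq0 expr2; have := x0 i (mem_index_enum i); rewrite mxE.
Qed.

Lemma enorm2_eq1 (R : realType) (a : 'cV[R]_2) :
  enorm a = 1 <-> a 0 0 ^+ 2 + a 1 0 ^+ 2 = 1.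
Proof.
rewrite /enorm big_ord_recl big_ord1 (_ : lift _ _ = 1); last exact: val_inj.
split=> [h | ->]; last exact: sqrtr1.
rewrite -[LHS]sqr_sqrtr ?h ?expr1n //.
by apply: addr_ge0; exact: sqr_ge0.
Qed.

Lemma symmetricmxP (R : realType) (n : nat) (A : 'M[R]_n) :
  A \is symmetricmx -> A^T = A.
Proof.
rewrite qualifE /= expr0 scale1r => /eqP {2}->.
by apply/matrixP => i j; rewrite !mxE.
Qed.

Lemma quadform_mul_sym (R : realType) (n : nat) (A B : 'M[R]_n) (u : 'cV[R]_n) :
  A \is symmetricmx -> quadform (A *m B) u = ((A *m u)^T *m (B *m u)) 0 0.
Proof. by move=> /symmetricmxP sA; rewrite /quadform trmx_mul sA !mulmxA. Qed.

Lemma dotmxC (R : comNzRingType) (n : nat) (x y : 'cV[R]_n) :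
  (x^T *m y) 0 0 = (y^T *m x) 0 0.
Proof. by rewrite !mxE; apply: eq_bigr => i _; rewrite !mxE mulrC. Qed.

(** * The squared residual and the Gram matrix in terms of three scalars *)

Lemma pencil_residual_sqr (R : realType) (n : nat) (A B : 'M[R]_n)
    (u : 'cV[R]_n) (a : 'cV[R]_2) :
  A \is symmetricmx -> B \is symmetricmx ->
  pencil_residual A B u a ^+ 2 =
    quadform (B *m B) u * a 0 0 ^+ 2
    - 2 * quadform (A *m B) u * a 0 0 * a 1 0
    + quadform (A *m A) u * a 1 0 ^+ 2.
Proof.
move=> sA sB; rewrite /pencil_residual enorm_sqr !quadform_mul_sym //.
set p := B *m u; set q := A *m u.
rewrite [(_ - _)^T]linearB /= ![(_ *: _)^T]linearZ /=.
rewrite !(mulmxBl, mulmxBr) -!(scalemxAl, scalemxAr).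
move: (dotmxC _ _ p q); move: (p^T *m p) (p^T *m q) (q^T *m p) (q^T *m q).
by move=> pp pq qp qq; rewrite !mxE => ->; ring.
Qed.

Lemma pencil_gram (R : realType) (n : nat) (A B : 'M[R]_n) (u : 'cV[R]_n) :
  A \is symmetricmx -> B \is symmetricmx ->
  let G := (pencil_mx A B u)^T *m pencil_mx A B u in
  [/\ G 0 0 = quadform (B *m B) u, G 0 1 = - quadform (A *m B) u,
      G 1 0 = - quadform (A *m B) u & G 1 1 = quadform (A *m A) u].
Proof.
move=> sA sB G; rewrite !quadform_mul_sym // {}/G /pencil_mx.
set p := B *m u; set q := A *m u.
have p0 i : row_mx p (- q) i 0 = p i 0.
  by rewrite -(row_mxEl p (- q) i 0); congr (row_mx _ _ _ _); exact: val_inj.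
have q1 i : row_mx p (- q) i 1 = - q i 0.
  have <- : (- q) i 0 = - q i 0 by rewrite mxE.
  by rewrite -(row_mxEr p (- q) i 0); congr (row_mx _ _ _ _); exact: val_inj.
move: (row_mx _ _) p0 q1 => C p0 q1; move: p q p0 q1 => p q p0 q1.
rewrite !mxE -!sumrN.
by split; apply: eq_bigr => i _; rewrite !mxE ?p0 ?q1; ring.
Qed.

(** As [c] is nonzero, the square root strictly exceeds [|s - t|], and [2 (t - mu)] is [t - s] plus
    that root. The product identity says that [mu] is a root of [(s - x) (t - x) - c^2]. *)
Lemma min_eigenvalue_completion (R : rcfType) (s t c mu : R) :
  c != 0 -> mu = 2^-1 * (s + t - Num.sqrt ((s - t) ^+ 2 + 4 * c ^+ 2)) ->
  0 < t - mu /\ (t - mu) * (s - mu) = c ^+ 2.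
Proof.
move=> c0 ->; set D := (s - t) ^+ 2 + _.
have cgt : 0 < c ^+ 2 by rewrite exprn_even_gt0.
have Dlt : `|s - t| < Num.sqrt D.
  rewrite -sqrtr_sqr ltr_sqrt /D; first by rewrite ltrDl; lra.
  by have := sqr_ge0 (s - t); lra.
have Dsq : Num.sqrt D ^+ 2 = D.
  by rewrite sqr_sqrtr // /D; have := sqr_ge0 (s - t); lra.
move: (Num.sqrt D) Dlt Dsq => S Slt Ssq; split.
  by have := ler_norm (s - t); lra.
by move: Ssq; rewrite /D => Ssq; field: Ssq.
Qed.

(** The equation is the first row of [(M - mu) a = 0]. The second row follows from it: multiplied by
    [t - mu], it becomes [c] times the first, since the determinant of [M - mu] vanishes. *)
Lemma unit_eigenvector2P (R : realType) (M : 'M[R]_2) (a : 'cV[R]_2)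
    (s t c mu : R) :
  M 0 0 = t -> M 0 1 = - c -> M 1 0 = - c -> M 1 1 = s ->
  0 < t - mu -> (t - mu) * (s - mu) = c ^+ 2 ->
  unit_eigenvector M mu a <->
  a 0 0 ^+ 2 + a 1 0 ^+ 2 = 1 /\ (t - mu) * a 0 0 = c * a 1 0.
Proof.
move=> M00 M01 M10 M11 k0 kc; rewrite /unit_eigenvector enorm2_eq1.
have Ma i : (M *m a) i 0 = M i 0 * a 0 0 + M i 1 * a 1 0.
  rewrite mxE big_ord_recl big_ord1 (_ : lift _ _ = 1) //; exact: val_inj.
split=> [[eM ->] | [-> e]]; split=> //.
  have := congr1 (fun x : 'cV_2 => x 0 0) eM.
  by rewrite Ma M00 M01 mxE => ?; lra.
apply: cV2P; rewrite Ma ?M00 ?M01 ?M10 ?M11 mxE; first by lra.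
apply: (mulfI (lt0r_neq0 k0)); apply/eqP; rewrite -subr_eq0; apply/eqP.
transitivity (c * (c * a 1 0 - (t - mu) * a 0 0)
    + ((t - mu) * (s - mu) - c ^+ 2) * a 1 0); first by ring.
by rewrite e kc; ring.
Qed.

(** * Unit vectors on the line [k x = c y] *)

Lemma unit_solution (R : rcfType) (c k : R) :
  0 < k ->
  exists2 a : 'cV[R]_2, a 0 0 ^+ 2 + a 1 0 ^+ 2 = 1 & k * a 0 0 = c * a 1 0.
Proof.
move=> k0; pose r := Num.sqrt (c ^+ 2 + k ^+ 2).
have r2 : r ^+ 2 = c ^+ 2 + k ^+ 2 by rewrite sqr_sqrtr // addr_ge0 ?sqr_ge0.
have rn0 : r != 0.
  have := exprn_gt0 2 k0; have := sqr_ge0 c.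
  by rewrite -sqrf_eq0 r2 => ? ?; rewrite lt0r_neq0 //; lra.
(* The vector [(c, k)] spans the line; dividing by its norm [r] makes it a unit vector. *)
exists (\col_i (if i == 0 then c / r else k / r)); rewrite !mxE /=;
  last by ring.
by rewrite !expr_div_n -mulrDl -r2 divff // sqrf_eq0.
Qed.

Lemma unit_solution_uniq (R : realFieldType) (c k : R) (a b : 'cV[R]_2) :
  0 < k ->
  a 0 0 ^+ 2 + a 1 0 ^+ 2 = 1 -> k * a 0 0 = c * a 1 0 ->
  b 0 0 ^+ 2 + b 1 0 ^+ 2 = 1 -> k * b 0 0 = c * b 1 0 ->
  b = a \/ b = - a.
Proof.
move=> k0 na ea nb eb; have kn0 := lt0r_neq0 k0.
have a0 : a 0 0 = c / k * a 1 0 by rewrite mulrAC -ea mulrAC divff ?mul1r.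
have b0 : b 0 0 = c / k * b 1 0 by rewrite mulrAC -eb mulrAC divff ?mul1r.
have w0 : 1 + (c / k) ^+ 2 != 0 by rewrite lt0r_neq0 // ltr_wpDr ?sqr_ge0.
have /eqP : b 1 0 ^+ 2 = a 1 0 ^+ 2.
  by apply: (mulfI w0); move: na nb; rewrite a0 b0; lra.
rewrite eqf_sqr => /orP[/eqP e1 | /eqP e1]; [left | right].
  by apply: cV2P => //; rewrite a0 b0 e1.
by apply: cV2P; rewrite !mxE // a0 b0 e1 mulrN.
Qed.

(** * Minimizers of the residual *)

(** On the unit circle the squared residual is [mu] plus a nonnegative term. Some unit vector makes
    this term vanish, so minimizing means making it vanish. *)
Lemma unit_minimizerP (R : realType) (n : nat) (A B : 'M[R]_n) (u : 'cV[R]_n)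
    (mu k c : R) (a : 'cV[R]_2) :
  0 < k ->
  (forall b : 'cV[R]_2, pencil_residual A B u b ^+ 2 =
    mu * (b 0 0 ^+ 2 + b 1 0 ^+ 2) + (k * b 0 0 - c * b 1 0) ^+ 2 / k) ->
  unit_minimizer A B u a <->
  a 0 0 ^+ 2 + a 1 0 ^+ 2 = 1 /\ k * a 0 0 = c * a 1 0.
Proof.
move=> k0 res.
have res0 b : 0 <= pencil_residual A B u b by exact: sqrtr_ge0.
split=> -[a1 amin]; split=> //.
  have [b bn eb] := unit_solution _ c _ k0.
  have := amin b bn; rewrite -ler_sqr ?nnegrE // !res a1 bn eb subrr.
  rewrite expr0n mul0r addr0 gerDl pmulr_lle0 ?invr_gt0 // => h.
  have /eqP : (k * a 0 0 - c * a 1 0) ^+ 2 == 0 by rewrite eq_le h sqr_ge0.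
  by move/eqP; rewrite sqrf_eq0 subr_eq0 => /eqP.
move=> b bn; rewrite -ler_sqr ?nnegrE // !res a1 bn amin subrr.
by rewrite expr0n mul0r addr0 lerDl divr_ge0 ?sqr_ge0 ?ltW.
Qed.

Lemma sqr_sum_gt0 (R : realType) (a : 'cV[R]_2) :
  a != 0 -> 0 < a 0 0 ^+ 2 + a 1 0 ^+ 2.
Proof.
apply: contraNT; rewrite -leNgt => le0.
have /andP[/eqP a0 /eqP a1] : (a 0 0 == 0) && (a 1 0 == 0).
  rewrite -[a 0 0 == 0]sqrf_eq0 -[a 1 0 == 0]sqrf_eq0 -paddr_eq0 ?sqr_ge0 // eq_le le0.
  by rewrite addr_ge0 ?sqr_ge0.
by apply/eqP/cV2P; rewrite ?a0 ?a1 mxE.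
Qed.

(** The same argument after division by the squared norm: the squared ratio is [mu] plus a
    nonnegative term. *)
Lemma projective_minimizerP (R : realType) (n : nat) (A B : 'M[R]_n)
    (u : 'cV[R]_n) (mu k c : R) (a : 'cV[R]_2) :
  0 < k ->
  (forall b : 'cV[R]_2, pencil_residual A B u b ^+ 2 =
    mu * (b 0 0 ^+ 2 + b 1 0 ^+ 2) + (k * b 0 0 - c * b 1 0) ^+ 2 / k) ->
  projective_minimizer A B u a <-> a != 0 /\ k * a 0 0 = c * a 1 0.
Proof.
move=> k0 res.
have ratio_ge0 b : 0 <= pencil_residual A B u b /
    Num.sqrt (b 0 0 ^+ 2 + b 1 0 ^+ 2) by rewrite divr_ge0 ?sqrtr_ge0.
have ratio b : b != 0 ->
    (pencil_residual A B u b / Num.sqrt (b 0 0 ^+ 2 + b 1 0 ^+ 2)) ^+ 2 =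
    mu + (k * b 0 0 - c * b 1 0) ^+ 2 / k / (b 0 0 ^+ 2 + b 1 0 ^+ 2).
  move=> /sqr_sum_gt0 b0; rewrite expr_div_n res sqr_sqrtr ?ltW // mulrDl.
  by rewrite mulfK // lt0r_neq0.
split=> -[a0 amin]; split=> //; have sa := sqr_sum_gt0 _ _ a0.
  (* The competitor [(c, k)] attains the bound [mu]; being nonzero suffices here, so it is not
     normalized. *)
  pose b : 'cV[R]_2 := \col_i (if i == 0 then c else k).
  have b0 : b 0 0 = c by rewrite mxE.
  have b1 : b 1 0 = k by rewrite mxE.
  have bn0 : b != 0.
    by apply: contraTneq k0 => eb; rewrite -b1 eb mxE ltxx.
  have := amin b bn0; rewrite -ler_sqr ?nnegrE // !ratio // b0 b1.
  rewrite (_ : k * c - _ = 0); last by ring.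
  rewrite expr0n !mul0r addr0 gerDl.
  rewrite pmulr_lle0 ?invr_gt0 // pmulr_lle0 ?invr_gt0 // => h.
  have /eqP : (k * a 0 0 - c * a 1 0) ^+ 2 == 0 by rewrite eq_le h sqr_ge0.
  by move/eqP; rewrite sqrf_eq0 subr_eq0 => /eqP.
move=> b b0; have sb := sqr_sum_gt0 _ _ b0.
rewrite -ler_sqr ?nnegrE // !ratio // amin subrr expr0n !mul0r addr0.
by rewrite lerDl !divr_ge0 ?sqr_ge0 ?ltW.
Qed.

Theorem proposition6 (R : realType) (n : nat) (A B : 'M[R]_n) (u : 'cV[R]_n)
    (mu : R) :
  A \is symmetricmx ->
  posdefmx B ->
  quadform (A *m B) u != 0 ->
  let C := pencil_mx A B u in
  smallest_eigenvalue (C^T *m C) mu ->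
  let uAAu := quadform (A *m A) u in
  let uBBu := quadform (B *m B) u in
  let uABu := quadform (A *m B) u in
  let disc := (uAAu - uBBu) ^+ 2 + 4 * uABu ^+ 2 in
  let theta := uABu / uBBu in
  let theta' := uAAu / uABu in
  (* (i) *)
  [/\ simple_eigenvalue (C^T *m C) mu,
      simple_singular_value C (Num.sqrt mu),
      (exists a : 'cV[R]_2, unit_eigenvector (C^T *m C) mu a) &
      forall a : 'cV[R]_2, unit_eigenvector (C^T *m C) mu a ->
        forall b : 'cV[R]_2, unit_minimizer A B u b <-> b = a \/ b = - a] /\
  (* (ii) *)
  mu = 2^-1 * (uAAu + uBBu - Num.sqrt disc) /\
  (* (iii) *)
  ((forall a : 'cV[R]_2, unit_eigenvector (C^T *m C) mu a ->
      a 1 0 != 0 /\ gen_hom_rayleigh_quotient A B u (a 0 0 / a 1 0)) /\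
   (forall alpha : R, gen_hom_rayleigh_quotient A B u alpha ->
      alpha = (2 * uABu)^-1 * (uAAu - uBBu + Num.sqrt disc))) /\
  (* (iv) *)
  ((mu = 0 <-> gen_eigenvector A B u) /\
   (forall alpha l : R, gen_hom_rayleigh_quotient A B u alpha ->
      gen_eigenpair A B l u -> alpha = l)) /\
  (* (v) *)
  0 <= mu < Num.min uAAu uBBu /\
  (* (vi) *)
  (forall alpha : R, gen_hom_rayleigh_quotient A B u alpha ->
     (0 < uABu -> theta <= alpha <= theta') /\
     (uABu < 0 -> theta' <= alpha <= theta)).
Proof.
move=> sA [sB _] c0 C [eigmu minmu] s t c disc theta theta'.
have [G00 G01 G10 G11] := pencil_gram _ _ _ _ u sA sB.
rewrite -/C -/s -/t -/c in G00 G01 G10 G11.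
set G := C^T *m C in eigmu minmu G00 G01 G10 G11 *.
have res := fun b => pencil_residual_sqr _ _ _ _ u b sA sB.
rewrite -/s -/t -/c in res c0.
have D0 : 0 < disc.
  have : 0 < c ^+ 2 by rewrite exprn_even_gt0.
  by rewrite /disc; have := sqr_ge0 (s - t); lra.
have Dsq : Num.sqrt disc ^+ 2 = disc by rewrite sqr_sqrtr // ltW.
have S0 : 0 < Num.sqrt disc by rewrite sqrtr_gt0.
(* The roots of [x^2 - (s + t) x + (s t - c^2)], whose discriminant is [disc]. *)
pose r := 2^-1 * (s + t - Num.sqrt disc).
pose r' := 2^-1 * (s + t + Num.sqrt disc).
have charG : char_poly G = ('X - r%:P) * ('X - r'%:P).
  apply: char_poly2_roots; rewrite ?G00 ?G01 ?G10 ?G11 /r /r'; first by field.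
  by move: Dsq; rewrite /disc => Dsq; field: Dsq.
have ltrr' : r < r' by rewrite /r /r'; lra.
have eigG l : eigenvalue G l = (l == r) || (l == r').
  by rewrite eigenvalue_root_char charG rootM !root_XsubC.
have mu_r : mu = r.
  have : mu <= r by apply: minmu; rewrite eigG eqxx.
  by move: eigmu; rewrite eigG => /orP[/eqP //|/eqP ->]; rewrite leNgt ltrr'.
have [k0 kc] := min_eigenvalue_completion _ _ _ _ _ c0 mu_r.
have sk0 : 0 < s - mu by rewrite -(pmulr_rgt0 _ k0) kc exprn_even_gt0.
have simple : simple_eigenvalue G mu.
  rewrite /simple_eigenvalue charG mu_r mupMl.
    by rewrite -['X - r%:P]expr1 mup_XsubCX eqxx.
  by rewrite root_XsubC lt_eqF.
have hres b : pencil_residual A B u b ^+ 2 = mu * (b 0 0 ^+ 2 + b 1 0 ^+ 2) +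
    ((t - mu) * b 0 0 - c * b 1 0) ^+ 2 / (t - mu).
  have kn0 := lt0r_neq0 k0.
  have ck : c ^+ 2 / (t - mu) = s - mu by rewrite -kc mulrAC divff ?mul1r.
  rewrite res sqrrB exprMn [(c * _) ^+ 2]exprMn !mulrDl [c ^+ 2 * _ / _]mulrAC ck.
  by field.
have eigP a : unit_eigenvector G mu a <->
    a 0 0 ^+ 2 + a 1 0 ^+ 2 = 1 /\ (t - mu) * a 0 0 = c * a 1 0.
  exact: (unit_eigenvector2P _ _ _ _ _ _ _ G00 G01 G10 G11 k0 kc).
have minP a := unit_minimizerP _ _ _ _ _ _ _ _ a k0 hres.
have projP a := projective_minimizerP _ _ _ _ _ _ _ _ a k0 hres.
have [a an ea] := unit_solution _ c _ k0.
(* At the unit solution [a] the squared residual equals [mu]. *)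
have mu0 : 0 <= mu.
  have := sqr_ge0 (pencil_residual A B u a).
  by rewrite hres an ea subrr expr0n mul0r addr0 mulr1.
have eig_n0 b : unit_eigenvector G mu b -> b 1 0 != 0.
  move=> /eigP[bn eb]; apply/eqP => b1; move: eb bn; rewrite b1 mulr0 => /eqP.
  rewrite mulf_eq0 (gt_eqF k0) /= => /eqP ->.
  by rewrite expr0n addr0 => /esym/eqP; rewrite oner_eq0.
(* All admissible minimizers share the ratio [c / (t - mu)], so the quotient relation is
   single-valued. *)
have quotP alpha : gen_hom_rayleigh_quotient A B u alpha ->
    (t - mu) * alpha = c.
  by move=> [b [/projP[_ eb] b1 ->]]; rewrite mulrA eb mulfK.
(* The residual vanishes at [(l, 1)]. Its square is a sum of two nonnegative terms, so both are
   zero. *)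
have eigpairP l : gen_eigenpair A B l u -> mu = 0 /\ (t - mu) * l = c.
  case=> _ Au; pose b : 'cV[R]_2 := \col_i (if i == 0 then l else 1).
  have b0 : b 0 0 = l by rewrite mxE.
  have b1 : b 1 0 = 1 by rewrite mxE.
  have /eqP := hres b; rewrite /pencil_residual b0 b1 scale1r Au subrr.
  rewrite enorm_sqr mulmx0 mxE expr1n mulr1 eq_sym.
  have l1 : 0 < l ^+ 2 + 1 by rewrite ltr_wpDl ?sqr_ge0.
  rewrite paddr_eq0; first last.
  - by rewrite divr_ge0 ?sqr_ge0 ?ltW.
  - by rewrite mulr_ge0 // ltW.
  rewrite !mulf_eq0 invr_eq0 (gt_eqF l1) (gt_eqF k0) !orbF orbb subr_eq0.
  by case/andP=> /eqP -> /eqP ->.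
split; [|split; [|split; [|split; [|split]]]].
- split=> //.
  + by split; [exact: sqrtr_ge0 | rewrite sqr_sqrtr].
  + by exists a; apply/eigP.
  + move=> x /eigP[xn ex] b; split=> [/minP[bn eb] | ].
      exact: unit_solution_uniq ex bn eb.
    case=> ->; apply/minP => //; rewrite !mxE !sqrrN; split=> //.
    by rewrite !mulrN ex.
- exact: mu_r.
- split=> [b eb | alpha /quotP e].
    have b1 := eig_n0 _ eb; split=> //; exists b; split=> //.
    case/eigP: eb => bn eb; apply/projP; split=> //.
    by apply: contraNneq b1 => ->; rewrite mxE.
  (* Since [2 (t - mu) = t - s + Num.sqrt disc], multiplying by [t - mu] gives a difference of
     squares, [disc - (s - t)^2 = 4 c^2]. *)
  apply: (mulfI (lt0r_neq0 k0)); rewrite e -[RHS]/(_ * (_ * (s - t + _))).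
  rewrite mu_r /r; move: Dsq; rewrite /disc => Dsq.
  by field: Dsq.
- split; first split.
  (* With [mu = 0] the line is [t x = c y]; its point [(c / t, 1)] has zero residual, which is the
     eigenvalue equation. *)
  + move=> mu_eq0; exists (c / t); split.
      by apply: contra_neq c0 => u0; rewrite /c /quadform u0 mulmx0 mxE.
    have t0 : t != 0 by apply: lt0r_neq0; move: k0; rewrite mu_eq0 subr0.
    pose b : 'cV[R]_2 := \col_i (if i == 0 then c / t else 1).
    have b0 : b 0 0 = c / t by rewrite mxE.
    have b1 : b 1 0 = 1 by rewrite mxE.
    have /eqP := hres b; rewrite b0 b1 mu_eq0 subr0 mul0r add0r mulr1.
    rewrite [t * _]mulrC divfK // subrr expr0n mul0r sqrf_eq0.
    move=> /eqP/enorm_eq0/eqP.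
    by rewrite b0 b1 scale1r subr_eq0 eq_sym => /eqP.
  + by case=> l /eigpairP[].
  + move=> alpha l /quotP ea' /eigpairP[_ el].
    by apply: (mulfI (lt0r_neq0 k0)); rewrite ea' el.
- by rewrite mu0 lt_min -[mu < s]subr_gt0 -[mu < t]subr_gt0 sk0 k0.
- move=> alpha /quotP e.
  have t0 : 0 < t by lra.
  (* As [s - mu > 0], this gives [alpha] the sign of [c]. The next two identities measure the gaps
     to [theta] and [theta'] by [mu], which is nonnegative, so the sign of [c] decides both
     inequalities. *)
  have ec : c * alpha = s - mu.
    by apply: (mulfI (lt0r_neq0 k0)); rewrite kc mulrCA e.
  have et : t * (alpha - theta) = mu * alpha.
    by rewrite mulrBr [t * theta]mulrC divfK ?lt0r_neq0 // -e; ring.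
  have es : c * (theta' - alpha) = mu by rewrite mulrBr mulrC divfK // ec; ring.
  split=> hc.
    have alpha0 : 0 < alpha by rewrite -(pmulr_rgt0 _ hc) ec.
    apply/andP; split; rewrite -subr_ge0.
      by rewrite -(pmulr_rge0 _ t0) et mulr_ge0 // ltW.
    by rewrite -(pmulr_rge0 _ hc) es.
  have alpha0 : alpha < 0 by rewrite -(nmulr_rgt0 _ hc) ec.
  apply/andP; split; rewrite -subr_le0.
    by rewrite -(nmulr_rge0 _ hc) es.
  by rewrite -(pmulr_rle0 _ t0) et mulr_ge0_le0 // ltW.
Qed.
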